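(* Assume that the labeled calibration set $\{(X_i,Y_i)\}_{i=1}^n$ and the test data are i.i.d., and that the unlabeled covariates $\{X_j\}_{j=n+1}^{n+N}$ are i.i.d. with $\{X_i\}_{i=1}^n$ and independent of the labeled calibration set. Let the loss $L$ be binary, i.e. with values in $\{0,1\}$. Let $\delta=\delta_1+\delta_2$ with $\delta_1,\delta_2>0$. Then the calibrated parameter $\hat q$ constructed by the semi-supervised RCPS procedure for a binary loss with control levels $(\alpha,\delta_1,\delta_2)$ satisfies $$\mathbb{P}_{D_U^{\mathrm{cal}},D_L^{\mathrm{cal}}}\big(R(\hat q)\le\alpha\big)\ge 1-\delta ,$$ where $R(q)=\mathbb{E}[L(Y,\mathcal{T}_q(X))]$.
   Context: Features take values in $\mathcal{X}$ and responses in $\mathcal{Y}$. For each value of the tunable parameter $q$, $\mathcal{T}_q$ is a prediction rule on $\mathcal{X}$ built from a pre-trained model, and $L(Y,\mathcal{T}_q(X))\in\{0,1\}$ is the loss; the risk $R(q)$ is its expectation over a test sample $(X,Y)$, and is not assumed monotone in $q$. $D_L^{\mathrm{cal}}=\{(X_i,Y_i)\}_{i=1}^n$ is the labeled and $D_U^{\mathrm{cal}}=\{X_j\}_{j=n+1}^{n+N}$ the unlabeled calibration set. The imputed label $\tilde Y_j$ of $X_j$, $j=1,\dots,n+N$, is obtained from a fixed predictive model. Put $L_i(q)=L(Y_i,\mathcal{T}_q(X_i))$ for $1\le i\le n$, $\tilde L_j(q)=L(\tilde Y_j,\mathcal{T}_q(X_j))$ for $1\le j\le n+N$, and $(z)_+=\max\{z,0\}$.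 The probability is over both calibration sets, and $R(\hat q)$ is the function $R$ evaluated at the data-dependent $\hat q$. Empirical risks: $$\hat R_U(q)=\frac1N\sum_{j=n+1}^{n+N}\tilde L_j(q),\qquad \hat R^{\mathrm{clip}}_{\mathrm{rect}}(q)=\frac1n\sum_{i=1}^n\big(L_i(q)-\tilde L_i(q)\big)_+ .$$ Exact (Clopper–Pearson) upper confidence bounds, at levels $\delta_1$ and $\delta_2$ respectively: $$\hat R_U^+(q)=\sup\{r:\mathbb{P}(\mathrm{Binom}(N,r)\le \lceil N\hat R_U(q)\rceil)\ge\delta_1\},$$ $$\hat R^{\mathrm{clip}+}_{\mathrm{rect}}(q)=\sup\{r:\mathbb{P}(\mathrm{Binom}(n,r)\le \lceil n\hat R^{\mathrm{clip}}_{\mathrm{rect}}(q)\rceil)\ge\delta_2\},$$ with $r$ ranging over success probabilities and the empirical risks treated as fixed numbers inside these probabilities. Put $\hat R^+(q)=\hat R_U^+(q)+\hat R^{\mathrm{clip}+}_{\mathrm{rect}}(q)$. Semi-supervised RCPS procedure for a binary loss: given a pre-specified ordered grid $\mathcal{Q}_{\mathrm{grid}}$ of values of $q$, go through the values $q$ of the grid in order; for each, compute $\hat R^+(q)$; if $\hat R^+(q)<\alpha$, set $\hat q\leftarrow q$ and continue to the next value, otherwise break out of the loop. Output the calibrated parameter $\hat q$.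
   Formalization: The procedure leaves the calibrated parameter undefined when the grid is empty or its first value is rejected; the formal statement counts that outcome as satisfying the risk bound, since otherwise the claim fails, e.g. when every grid value has risk above α. *)

(* Defs.v *)
From HB Require Import structures.
From mathcomp Require Import all_boot all_order all_algebra.
From mathcomp Require Import all_classical all_reals all_analysis.
Set Implicit Arguments.
Unset Strict Implicit.
Unset Printing Implicit Defensive.

Import Order.TTheory GRing.Theory Num.Theory.
Local Open Scope classical_set_scope.
Local Open Scope ring_scope.

Section independence.
Context {d : measure_display} {Omega : measurableType d} {R : realType}.
Variable P : probability Omega R.

Definition mutually_independent {d' : measure_display} {S : measurableType d'}
    {I : finType} (Z : I -> Omega -> S) : Prop :=
  forall (J : {set I}) (A : I -> set S), (forall i, measurable (A i)) ->
    P (\bigcap_(i in [set` J]) Z i @^-1` A i)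
    = (\prod_(i in J) P (Z i @^-1` A i))%E.

Definition identically_distributed {d' : measure_display}
    {S : measurableType d'} {I : finType} (Z : I -> Omega -> S) : Prop :=
  forall (i j : I) (A : set S), measurable A ->
    P (Z i @^-1` A) = P (Z j @^-1` A).

Definition iid {d' : measure_display} {S : measurableType d'}
    {I : finType} (Z : I -> Omega -> S) : Prop :=
  mutually_independent Z /\ identically_distributed Z.

(* Independence of the two families as wholes, i.e. of the sigma-algebras that
   they generate; nothing is said about independence inside each family. *)
Definition independent_families {d1 d2 : measure_display}
    {S1 : measurableType d1} {S2 : measurableType d2} {m1 m2 : nat}
    (U : 'I_m1 -> Omega -> S1) (V : 'I_m2 -> Omega -> S2) : Prop :=
  forall A B : set Omega, g_sigma_preimage U A -> g_sigma_preimage V B ->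
    P (A `&` B) = (P A * P B)%E.

End independence.

(* The range of [r] is restricted explicitly because [binomial_prob m r] is a
   Dirac mass at 0 when [r] is not in [0, 1]. *)
Definition clopper_pearson_upper {R : realType} (m : nat) (delta rhat : R) : R :=
  sup [set r : R | 0 <= r <= 1 /\
    (delta%:E <= binomial_prob m r
                   [set k : nat | (k%:Z <= Num.ceil (m%:R * rhat))%R])%E].

(* [x] lists all n + N calibration features, the n labeled ones first; [y] lists
   the n labels. *)
Section semi_supervised_rcps.
Context {R : realType} {X Y Pred Q : Type}.
Variables (L : Y -> Pred -> R) (T : Q -> X -> Pred) (f : X -> Y).
Variables (n N : nat) (x : 'I_(n + N) -> X) (y : 'I_n -> Y).

Definition labeled_loss (i : 'I_n) (q : Q) : R :=
  L (y i) (T q (x (lshift N i))).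

Definition imputed_loss (j : 'I_(n + N)) (q : Q) : R :=
  L (f (x j)) (T q (x j)).

Definition unlabeled_risk (q : Q) : R :=
  N%:R^-1 * \sum_(j < N) imputed_loss (rshift n j) q.

Definition clipped_rectifier (q : Q) : R :=
  n%:R^-1 * \sum_(i < n)
    Num.max (labeled_loss i q - imputed_loss (lshift N i) q) 0.

Definition risk_ucb (delta1 delta2 : R) (q : Q) : R :=
  clopper_pearson_upper N delta1 (unlabeled_risk q)
  + clopper_pearson_upper n delta2 (clipped_rectifier q).

Fixpoint rcps_loop (accept : Q -> bool) (current : option Q) (grid : seq Q) :
    option Q :=
  if grid is q :: grid' then
    if accept q then rcps_loop accept (Some q) grid' else current
  else current.

(* [None] when no parameter is ever assigned, i.e. when the grid is empty or its
   first value is already rejected. *)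
Definition calibrated_parameter (alpha delta1 delta2 : R) (grid : seq Q) :
    option Q :=
  rcps_loop (fun q => risk_ucb delta1 delta2 q < alpha) None grid.

End semi_supervised_rcps.

Definition risk {R : realType} {d : measure_display} {Omega : measurableType d}
    (P : probability Omega R) {X Y Pred Q : Type}
    (L : Y -> Pred -> R) (T : Q -> X -> Pred)
    (Xtest : Omega -> X) (Ytest : Omega -> Y) (q : Q) : \bar R :=
  ('E_P[fun w => L (Ytest w) (T q (Xtest w))])%E.

(* The loop may end without selecting any parameter; no parameter is then
   deployed and no risk is incurred. *)
Definition risk_controlled {R : realType} {Q : Type} (r : Q -> \bar R)
    (alpha : R) (qhat : option Q) : Prop :=
  if qhat is Some q then (r q <= alpha%:E)%E else True.

(* Main.v *)
(* By L <= L~ + (L - L~)_+ with L~ the imputed loss, R(q) is at most the sum of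
   the success probabilities of the two Bernoulli samples behind the empirical
   risks. Hence if a value q with R(q) > alpha is accepted, one of the two
   Clopper-Pearson bounds undershoots its success probability, and a union bound
   over these two events concludes. *)

Require Import Defs.
From mathcomp Require Import all_boot all_order all_algebra.
From mathcomp Require Import all_classical all_reals all_analysis.
Import Order.TTheory GRing.Theory Num.Theory.
Local Open Scope classical_set_scope.
Local Open Scope ring_scope.

(** * The selection loop over the grid *)

(* The first inadmissible grid value does not depend on the data, and the loop
   can only end badly by accepting it: no union bound over the grid is needed. *)
Lemma rcps_loop_first_violation (Q : Type) (C : Q -> Prop) (grid : seq Q) :
  let ok o := if o is Some q then C q else True in
  (forall accept cur, ok cur -> ok (rcps_loop accept cur grid)) \/
  exists2 q, ~ C q & forall accept cur, ok cur ->
    ~ ok (rcps_loop accept cur grid) -> accept q.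
Proof.
move=> ok; elim: grid => [|q grid IH]; first by left.
have [Cq|nCq] := pselect (C q); last first.
  by right; exists q => // accept cur okcur /=; case: ifP.
case: IH => [IH|[q' nCq' IH]]; [left|right; exists q' => //] => accept cur okcur /=.
- by case: ifP => _ //; exact: IH.
- by case: ifP => _ //; exact: IH.
Qed.

(** * The random set of successful trials, and measurability through it *)

(** Taking values in a finite type, this random set turns every event about the empirical risks into
    a finite union of fibres. *)
Definition hits {Omega : Type} {I : finType} (E : I -> set Omega) (w : Omega) :
  {set I} := [set i | `[< E i w >]]%SET.

Lemma card_hitsE (R : realType) (Omega : Type) (I : finType)
    (E : I -> set Omega) (w : Omega) :
  #|hits E w|%:R = \sum_i \1_(E i) w :> R.
Proof.
rewrite -sum1_card natr_sum big_mkcond; apply: eq_bigr => i _.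
by rewrite indicE !inE; case: asboolP => Ei; [rewrite mem_set|rewrite memNset].
Qed.

(** Failures enter as complements, so the intersection runs over all trials and has the shape to
    which mutual independence applies. *)
Lemma hits_fiberE (Omega : Type) (I : finType) (E : I -> set Omega)
    (J : {set I}) :
  hits E @^-1` [set J] =
  \bigcap_(i in [set` [set: I]%SET]) (if i \in J then E i else ~` E i).
Proof.
apply/seteqP; split => w /=.
- by move=> <- i _; rewrite inE; case: ifPn => /asboolP.
- move=> H; apply/setP => i; rewrite inE; have := H i (finset.in_setT i).
  by case: ifPn => _ Ei; [apply/asboolP|apply/negbTE/asboolP].
Qed.

Section hits_measurability.
Context {d : measure_display} {Omega : measurableType d}.

(** Since [{set I}] is finite, [G] may be arbitrary; in particular it may involve a supremum such as
    [clopper_pearson_upper] whose own measurability is never examined. *)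
Lemma measurable_hits (I : finType) (E : I -> set Omega) (G : set {set I}) :
  (forall i, measurable (E i)) -> measurable (hits E @^-1` G).
Proof.
move=> mE.
have -> : hits E @^-1` G = \bigcup_(J in G) (hits E @^-1` [set J]).
  by apply/seteqP; split => [w Gw|w [J GJ /= ->]//]; exists (hits E w).
apply: fin_bigcup_measurable => [|J _]; first exact: finite_finset.
rewrite hits_fiberE; apply: fin_bigcap_measurable => [|i _].
  exact: finite_finpred.
by case: ifP => _ //; exact: measurableC.
Qed.

(** Two samples are handled jointly because acceptance compares a sum of two bounds, one from each
    sample, with [alpha]. *)
Lemma measurable_hits2 (I I' : finType) (E : I -> set Omega)
    (E' : I' -> set Omega) (G : {set I} -> {set I'} -> Prop) :
  (forall i, measurable (E i)) -> (forall i, measurable (E' i)) ->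
  measurable [set w | G (hits E w) (hits E' w)].
Proof.
move=> mE mE'.
have -> : [set w | G (hits E w) (hits E' w)] =
    \bigcup_(J in setT) (hits E @^-1` [set J] `&` hits E' @^-1` G J).
  apply/seteqP; split => [w Gw|w [J _ [/= -> //]]].
  by exists (hits E w).
apply: fin_bigcup_measurable => [|J _]; first exact: finite_finset.
by apply: measurableI; exact: measurable_hits.
Qed.

End hits_measurability.

(* As [p] belongs to no set whose supremum lies below it, no monotonicity of the
   binomial cdf in the success probability is needed. *)
Lemma clopper_pearson_upper_lt (R : realType) (m : nat) (delta rhat p : R) :
  0 <= p <= 1 -> clopper_pearson_upper m delta rhat < p ->
  (binomial_prob m p [set k : nat | (k%:Z <= Num.ceil (m%:R * rhat))%R]
   < delta%:E)%E.
Proof.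
move=> p01; rewrite !ltNge; apply: contra => le_delta.
(* [sup] is a genuine least upper bound here: the set contains [p] and is bounded by 1. *)
apply: sup_upper_bound => //; split; first by exists p.
by exists 1 => r [/andP[_]].
Qed.

(** The loop is a finite decision tree with measurable tests. [Q] carries no sigma-algebra, hence
    the arbitrary set [G] of outcomes. *)
Lemma measurable_rcps_loop (d : measure_display) (Omega : measurableType d)
    (Q : Type) (accept : Omega -> Q -> bool) (G : set (option Q))
    (cur : option Q) (grid : seq Q) :
  (forall q, measurable [set w | accept w q]) ->
  measurable [set w | G (rcps_loop (accept w) cur grid)].
Proof.
move=> mA.
have mcst (A : Prop) : measurable [set _ : Omega | A].
  have [a|na] := pselect A.
  - by rewrite (_ : [set _ | _] = setT) // -subTset.
  - by rewrite (_ : [set _ | _] = set0) // -subset0.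
elim: grid cur => [|q grid IH] cur /=; first exact: mcst.
have -> : [set w | G (if accept w q then rcps_loop (accept w) (Some q) grid
                      else cur)] =
    ([set w | accept w q] `&` [set w | G (rcps_loop (accept w) (Some q) grid)])
    `|` (~` [set w | accept w q] `&` [set _ | G cur]).
  apply/seteqP; split => w /=; first by case: ifP => [|/negP] *; [left|right].
  by case=> -[]; [move=> ->|move=> /negP/negbTE ->].
apply: measurableU; apply: measurableI => //; first exact: measurableC.
Qed.

(** * Binomial counts of independent trials and coverage of the exact bound *)

Section independent_trials.
Context {R : realType} {d dS : measure_display} {Omega : measurableType d}
  {S : measurableType dS}.
Variable P : probability Omega R.

(** Serves to extract the labeled pairs from the family that includes the test pair, and the
    unlabeled covariates from all covariates. Injectivity keeps distinct factors of the product
    distinct. *)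
Lemma mutually_independent_comp_inj (I I' : finType) (h : I' -> I)
    (Z : I -> Omega -> S) :
  injective h -> mutually_independent P Z ->
  mutually_independent P (fun i => Z (h i)).
Proof.
move=> h_inj indepZ J A mA.
(* The events are transported along the partial inverse of [h], with the sure event off its
   image. *)
pose A' k := if [pick i | h i == k] is Some i then A i else setT.
have A'h i : A' (h i) = A i.
  rewrite /A'; case: pickP => [k /eqP/h_inj -> //|/(_ i)].
  by rewrite eqxx.
have mA' k : measurable (A' k).
  by rewrite /A'; case: pickP => [i _|_]; [exact: mA|exact: measurableT].
have := indepZ [set h i | i in J]%SET A' mA'.
rewrite big_imset /=; last by move=> i j _ _; exact: h_inj.
under eq_bigr do rewrite A'h.
move=> <-; congr (P _); apply/seteqP; split => w H k /=.
- by move=> /imsetP[i iJ ->]; rewrite A'h; exact: H.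
- by move=> kJ; have := H _ (imset_f h kJ); rewrite /= A'h.
Qed.

Variables (m : nat) (Z : 'I_m -> Omega -> S) (B : set S) (p : R).
Hypotheses (mZ : forall i, measurable_fun [set: Omega] (Z i))
  (mB : measurable B) (indepZ : mutually_independent P Z)
  (PZ : forall i, P (Z i @^-1` B) = p%:E).

Let E i := Z i @^-1` B.

Let mE i : measurable (E i).
Proof. by rewrite -[E i]setTI; exact: mZ. Qed.

Lemma prob_hits_fiber (J : {set 'I_m}) :
  P (hits E @^-1` [set J]) = (p ^+ #|J| * (1 - p) ^+ (m - #|J|))%:E.
Proof.
rewrite hits_fiberE.
pose A i := if i \in J then B else ~` B.
have -> : \bigcap_(i in [set` [set: 'I_m]%SET]) (if i \in J then E i else ~` E i)
    = \bigcap_(i in [set` [set: 'I_m]%SET]) Z i @^-1` A i.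
  by apply: eq_bigcapr => i _; rewrite /A; case: ifP.
rewrite indepZ; last by move=> i; rewrite /A; case: ifP => _ //; exact: measurableC.
have PA i : P (Z i @^-1` A i) = (if i \in J then p else 1 - p)%:E.
  rewrite /A; case: ifP => _ //.
  by rewrite preimage_setC probability_setC ?PZ //; exact: mE.
under eq_bigr do rewrite PA.
rewrite prodEFin; congr EFin.
rewrite (bigID (mem J)) /=; congr (_ * _).
- rewrite (eq_bigl (fun i => i \in J)); last by move=> i; rewrite inE.
  rewrite (eq_bigr (fun=> p)); last by move=> i ->.
  by rewrite prodr_const.
- rewrite (eq_bigl (fun i => i \in ~: J)%SET); last by move=> i; rewrite !inE.
  rewrite (eq_bigr (fun=> 1 - p)); last by move=> i; rewrite inE => /negbTE ->.
  by rewrite prodr_const cardsCs finset.setCK card_ord.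
Qed.

(** The count is binomial: the fibres over the sets of size [k] are equiprobable, and the binomial
    coefficient counts them. *)
Lemma prob_card_hits (U : set nat) :
  0 <= p <= 1 -> P [set w | U #|hits E w|] = binomial_prob m p U.
Proof.
move=> /andP[p0 p1].
have -> : [set w | U #|hits E w|] =
    \bigcup_(J in [set` [pred J : {set 'I_m} | `[< U #|J| >]]])
      hits E @^-1` [set J].
  apply/seteqP; split => w /=.
  - by move=> Uw; exists (hits E w) => //=; apply/asboolP.
  - by move=> [J /= /asboolP UJ wJ]; rewrite wJ.
rewrite measure_fin_bigcup; [|exact: finite_finpred| |]; last first.
- by move=> J _; exact: measurable_hits.
- by move=> J K _ _ [w [/= <- <-]].
rewrite -(bigfs _ (r := index_enum _)) ?index_enum_uniq //; last first.
  by move=> J _; rewrite mem_index_enum.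
rewrite (@binomial_probE R m p p0 p1).
(* Fibres are grouped by size; [inord] is faithful because [#|J|] is at most [m]. *)
rewrite (partition_big (fun J : {set 'I_m} => inord #|J| : 'I_m.+1) predT) //=.
apply: eq_bigr => k _.
have cardk (J : {set 'I_m}) : (inord #|J| == k) = (#|J| == k).
  by rewrite -val_eqE /= inordK // ltnS -[leqRHS]card_ord max_card.
rewrite diracE; case: (pselect (U k)) => Uk.
- rewrite mem_set // mule1 /=.
  rewrite (eq_bigl (fun J => J \in [set J' : {set 'I_m} | #|J'| == k]%SET)); last first.
    move=> J; rewrite !inE cardk; case: eqP => [Jk|]; last by rewrite andbF.
    by rewrite andbT Jk; apply/asboolP.
  rewrite (eq_bigr (fun=> (p ^+ k * (1 - p) ^+ (m - k))%:E)); last first.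
    by move=> J; rewrite inE => /eqP <-; rewrite prob_hits_fiber.
  by rewrite sumEFin sumr_const card_draws card_ord.
- rewrite memNset // mule0 big1 // => J /andP[/asboolP UJ].
  by rewrite cardk => /eqP Jk; rewrite Jk in UJ.
Qed.

(** A bound below [p] forces the cdf [F] at the observed count below [delta]. The count is then at
    most the largest [j0] with [F j0 < delta], an event of probability exactly [F j0]. *)
Lemma clopper_pearson_noncoverage (delta : R) :
  (0 < m)%N -> 0 <= p <= 1 -> 0 <= delta ->
  (P [set w | (clopper_pearson_upper m delta (m%:R^-1 * #|hits E w|%:R) < p)%R]
   <= delta%:E)%E.
Proof.
move=> m_gt0 p01 delta_ge0.
pose F (j : nat) : \bar R := binomial_prob m p [set k : nat | (k <= j)%N].
have cp_lt w : clopper_pearson_upper m delta (m%:R^-1 * #|hits E w|%:R) < p ->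
    (F #|hits E w| < delta%:E)%E.
  move=> /(clopper_pearson_upper_lt _ _ _ _ _ p01).
  (* As [m] is positive, the rescaled empirical risk is the integer count itself and the ceiling has
     no effect. *)
  rewrite mulrA divff ?pnatr_eq0 -?lt0n // mul1r.
  suff -> : [set k : nat | k%:Z <= Num.ceil (#|hits E w|%:R : R)]
    = [set k : nat | (k <= #|hits E w|)%N] by [].
  have -> : Num.ceil (#|hits E w|%:R : R) = #|hits E w|%:Z.
    by rewrite -[#|_|%:R]/(#|_|%:Z%:~R) intrKceil.
  by apply/seteqP; split => k /=; rewrite lez_nat.
have [[j Fj]|noj] := pselect (exists j, (j <= m)%N && (F j < delta%:E)%E).
- have le_m k : (k <= m)%N && (F k < delta%:E)%E -> (k <= m)%N by case/andP.
  have [j0 /andP[_ Fj0] j0max] := ex_maxnP (ex_intro _ j Fj) le_m.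
  apply: (@le_trans _ _ (F j0)); last exact: ltW.
  rewrite /F -prob_card_hits //; apply: le_measure; rewrite ?inE.
  + by apply: (measurable_hits _ _
      [set J | clopper_pearson_upper m delta (m%:R^-1 * #|J|%:R) < p]).
  + by apply: (measurable_hits _ _ [set J | (#|J| <= j0)%N]).
  + move=> w /cp_lt Fw; apply: j0max; rewrite Fw andbT.
    by rewrite -[leqRHS]card_ord max_card.
(* If [F] stays at or above [delta] at every count, undershooting is impossible. *)
- rewrite [X in P X](_ : _ = set0) ?measure0 ?lee_fin //.
  rewrite -subset0 => w /cp_lt Fw; apply: noj; exists #|hits E w|.
  by rewrite Fw andbT -[leqRHS]card_ord max_card.
Qed.

End independent_trials.

Theorem proposition2 (R : realType)
  (d dX dY : measure_display)
  (Omega : measurableType d) (X : measurableType dX) (Y : measurableType dY)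
  (P : probability Omega R)
  (Pred Q : Type)
  (L : Y -> Pred -> R) (T : Q -> X -> Pred) (f : X -> Y)
  (n N : nat)
  (Xcal : 'I_(n + N) -> Omega -> X) (Ycal : 'I_n -> Omega -> Y)
  (Xtest : Omega -> X) (Ytest : Omega -> Y)
  (grid : seq Q) (alpha delta delta1 delta2 : R)
  (n_gt0 : (0 < n)%N) (N_gt0 : (0 < N)%N)
  (mXcal : forall j, measurable_fun [set: Omega] (Xcal j))
  (mYcal : forall i, measurable_fun [set: Omega] (Ycal i))
  (mXtest : measurable_fun [set: Omega] Xtest)
  (mYtest : measurable_fun [set: Omega] Ytest)
  (mf : measurable_fun [set: X] f)
  (mL : forall q : Q,
     measurable_fun [set: X * Y] (fun z : X * Y => L z.2 (T q z.1)))
  (L_binary : forall (y : Y) (p : Pred), L y p = 0 \/ L y p = 1)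
  (labeled_test_iid :
     iid P (fun (o : option 'I_n) (w : Omega) =>
              if o is Some i then (Xcal (lshift N i) w, Ycal i w)
              else (Xtest w, Ytest w)))
  (covariates_iid : iid P Xcal)
  (unlabeled_indep_labeled :
     independent_families P
       (fun (i : 'I_n) (w : Omega) => (Xcal (lshift N i) w, Ycal i w))
       (fun (j : 'I_N) => Xcal (rshift n j)))
  (delta1_gt0 : 0 < delta1) (delta2_gt0 : 0 < delta2)
  (delta_def : delta = delta1 + delta2) :
  ((1 - delta)%:E <=
   P [set w : Omega |
        risk_controlled (risk P L T Xtest Ytest) alpha
          (calibrated_parameter L T f
             (fun j => Xcal j w) (fun i => Ycal i w)
             alpha delta1 delta2 grid)])%E.
Proof.

(* Binary losses as indicators of events *)
have L01 (y : Y) (t : Pred) : L y t = 1 \/ L y t = 0.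
  by case: (L_binary y t); [right|left].
(* [B] is true loss 1, [BU] imputed loss 1, and [BL] true loss 1 with imputed loss 0: its indicator
   is the clipped difference of the losses. *)
pose B q : set (X * Y) := [set z | L z.2 (T q z.1) = 1].
pose BU q : set X := [set x | L (f x) (T q x) = 1].
pose BL q : set (X * Y) := B q `\` fst @^-1` BU q.
have mB q : measurable (B q).
  by rewrite -[B q]setTI; exact: (mL q measurableT _ (measurable_set1 1)).
have mBU q : measurable (BU q).
  (* [BU q] is the preimage of [B q] under the graph map of [f]. *)
  have mg : measurable_fun [set: X] (fun x => (x, f x)).
    exact: measurable_fun_pair.
  by rewrite -[BU q]setTI; exact: (mg measurableT _ (mB q)).
have mfstBU q : measurable (fst @^-1` BU q : set (X * Y)).
  by rewrite -[X in measurable X]setTI; exact: measurable_fst.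
have mBL q : measurable (BL q) by exact: measurableD.
pose Zcal i w := (Xcal (lshift N i) w, Ycal i w).
pose Ztest w := (Xtest w, Ytest w).
have mZcal i : measurable_fun setT (Zcal i) by exact: measurable_fun_pair.
have mZtest : measurable_fun setT Ztest by exact: measurable_fun_pair.
pose EU q j := Xcal (rshift n j) @^-1` BU q.
pose EL q i := Zcal i @^-1` BL q.
have mEU q j : measurable (EU q j) by rewrite -[EU q j]setTI; exact: mXcal.
have mEL q i : measurable (EL q i) by rewrite -[EL q i]setTI; exact: mZcal.
have unlabeledE q w : unlabeled_risk L T f (fun j => Xcal j w) q
    = N%:R^-1 * #|hits (EU q) w|%:R.
  congr (_ * _); rewrite card_hitsE; apply: eq_bigr => j _.
  rewrite /imputed_loss indicE.
  case: (L01 (f (Xcal (rshift n j) w)) (T q (Xcal (rshift n j) w))) => Lj.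
  - by rewrite mem_set // Lj.
  - by rewrite memNset // /EU /BU /= Lj => /esym/eqP; rewrite oner_eq0.
have rectifierE q w : clipped_rectifier L T f (fun j => Xcal j w)
    (fun i => Ycal i w) q = n%:R^-1 * #|hits (EL q) w|%:R.
  congr (_ * _); rewrite card_hitsE; apply: eq_bigr => i _.
  rewrite /labeled_loss /imputed_loss indicE.
  set x := Xcal _ w.
  case: (L01 (Ycal i w) (T q x)) => Li; case: (L01 (f x) (T q x)) => Lf;
    rewrite Li Lf ?subrr ?subr0 ?sub0r.
  - rewrite maxxx memNset // => -[_]; exact.
  - rewrite (max_idPl ler01) mem_set //; split => //=.
    by rewrite /BU /= Lf => /esym/eqP; rewrite oner_eq0.
  - rewrite (max_idPr _) ?oppr_le0 ?ler01 // memNset // => -[+ _].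
    by rewrite /B /= Li => /esym/eqP; rewrite oner_eq0.
  - rewrite maxxx memNset // => -[+ _].
    by rewrite /B /= Li => /esym/eqP; rewrite oner_eq0.
pose accept w q := risk_ucb L T f (fun j => Xcal j w) (fun i => Ycal i w)
  delta1 delta2 q < alpha.
have maccept q : measurable [set w | accept w q].
  rewrite (_ : [set w | _] = [set w |
      (clopper_pearson_upper N delta1 (N%:R^-1 * #|hits (EU q) w|%:R)
       + clopper_pearson_upper n delta2 (n%:R^-1 * #|hits (EL q) w|%:R)
       < alpha)%R]); last first.
    by apply/seteqP; split => w; rewrite /accept /risk_ucb /= unlabeledE rectifierE.
  exact: (measurable_hits2 _ _ (EU q) (EL q) (fun J K =>
      clopper_pearson_upper N delta1 (N%:R^-1 * #|J|%:R)
      + clopper_pearson_upper n delta2 (n%:R^-1 * #|K|%:R) < alpha)).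

(* Success probabilities at the test point, and the risk *)
pose pU q := fine (P (Xtest @^-1` BU q)).
pose pL q := fine (P (Ztest @^-1` BL q)).
have mXtestBU q : measurable (Xtest @^-1` BU q).
  by rewrite -[X in measurable X]setTI; exact: mXtest.
have mZtestBL q : measurable (Ztest @^-1` BL q).
  by rewrite -[X in measurable X]setTI; exact: mZtest.
have prob01 (A : set Omega) : measurable A -> 0 <= fine (P A) <= 1.
  move=> mA; rewrite fine_ge0 // -lee_fin fineK ?fin_num_measure //.
  exact: probability_le1.
(* The risk is the probability of [B q] at the test pair, and [B q] is covered by [BU q] and
   [BL q]. *)
have risk_le q : (risk P L T Xtest Ytest q <= (pU q + pL q)%:E)%E.
  have mZB : measurable (Ztest @^-1` B q).
    by rewrite -[X in measurable X]setTI; exact: mZtest.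
  rewrite (_ : risk _ _ _ _ _ q = P (Ztest @^-1` B q)); last first.
    rewrite -expectation_indic //; congr expectation; apply/funext => w.
    rewrite indicE; case: (L01 (Ytest w) (T q (Xtest w))) => Lw.
    - by rewrite mem_set // Lw.
    - by rewrite memNset // /B /= Lw => /esym/eqP; rewrite oner_eq0.
  rewrite EFinD !fineK ?fin_num_measure //.
  apply: (le_trans _ (measureU2 _ _ _)) => //.
  apply: le_measure; rewrite ?inE //; first exact: measurableU.
  move=> w Bw; have [BUw|nBUw] := pselect (BU q (Xtest w)); [by left|by right].
have [indepZ identZ] := labeled_test_iid.
have [indepX identX] := covariates_iid.
have PZcal i A : measurable A -> P (Zcal i @^-1` A) = P (Ztest @^-1` A).
  exact: (identZ (Some i) None).
have PEL q i : P (EL q i) = (pL q)%:E.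
  by rewrite PZcal // fineK ?fin_num_measure.
have PEU q j : P (EU q j) = (pU q)%:E.
  (* An unlabeled covariate is linked to the test feature through the first labeled one, which
     exists by [n_gt0]: [identX] gives one link, the law of the labeled pairs the other. *)
  rewrite /EU (identX (rshift n j) (lshift N (Ordinal n_gt0))) //.
  by rewrite fineK ?fin_num_measure //; exact: (PZcal _ _ (mfstBU q)).
have indepZcal : mutually_independent P Zcal.
  exact: (mutually_independent_comp_inj P _ _ Some _ Some_inj indepZ).
have indepXU : mutually_independent P (fun j => Xcal (rshift n j)).
  by apply: mutually_independent_comp_inj indepX; exact: rshift_inj.

(* Failure of the loop and the union bound *)
pose good w := risk_controlled (risk P L T Xtest Ytest) alpha
  (rcps_loop (accept w) None grid).
have mgood : measurable [set w | good w] by exact: measurable_rcps_loop.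
rewrite [X in P X](_ : _ = [set w | good w]) //.
(* Either every run ends well, or one deterministic [q] is accepted in every bad run; being fixed in
   advance, it is subject to the coverage bounds. *)
have [all_good|[q /negP risk_q bad_accept]] := rcps_loop_first_violation _
    (fun q => (risk P L T Xtest Ytest q <= alpha%:E)%E) grid.
  rewrite (_ : [set w | _] = setT); last first.
    by rewrite -subTset => w _; exact: all_good.
  by rewrite probability_setT lee_fin delta_def gerBl addr_ge0 ?ltW.
pose missU := [set w | (clopper_pearson_upper N delta1
  (N%:R^-1 * #|hits (EU q) w|%:R) < pU q)%R].
pose missL := [set w | (clopper_pearson_upper n delta2
  (n%:R^-1 * #|hits (EL q) w|%:R) < pL q)%R].
have mmissU : measurable missU.
  exact: (measurable_hits _ (EU q) [set J |
    clopper_pearson_upper N delta1 (N%:R^-1 * #|J|%:R) < pU q]).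
have mmissL : measurable missL.
  exact: (measurable_hits _ (EL q) [set J |
    clopper_pearson_upper n delta2 (n%:R^-1 * #|J|%:R) < pL q]).
have PmissU : (P missU <= delta1%:E)%E.
  apply: (clopper_pearson_noncoverage P _ (fun j => Xcal (rshift n j)) (BU q)) => //.
  - by move=> j; exact: PEU.
  - exact: prob01.
  - exact: ltW.
have PmissL : (P missL <= delta2%:E)%E.
  apply: (clopper_pearson_noncoverage P _ Zcal (BL q)) => //.
  - by move=> i; exact: PEL.
  - exact: prob01.
  - exact: ltW.
(* If both bounds reached [pU q] and [pL q], their sum would exceed [alpha], contradicting the
   acceptance of [q]. *)
have bad_miss : ~` [set w | good w] `<=` missU `|` missL.
  move=> w bad_w; have := bad_accept (accept w) None I bad_w.
  rewrite /accept /risk_ucb unlabeledE rectifierE => ucb_lt.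
  have alpha_lt : alpha < pU q + pL q.
    by rewrite -lte_fin; apply: lt_le_trans (risk_le q); rewrite ltNge.
  apply: contrapT => /not_orP[/negP + /negP +]; rewrite -!leNgt => leU leL.
  by have := lt_trans ucb_lt alpha_lt; rewrite ltNge lerD.
have : (P (~` [set w | good w]) <= delta%:E)%E.
  rewrite delta_def EFinD; apply: le_trans (leeD PmissU PmissL).
  apply: (le_trans _ (measureU2 _ _ _)) => //.
  by apply: le_measure => //; rewrite inE; [exact: measurableC|exact: measurableU].
rewrite probability_setC // -(fineK (fin_num_measure P _ mgood)) -EFinB !lee_fin.
by rewrite lerBlDr lerBlDl addrC.
Qed.
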